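(* Let $G$ be an infinite discrete group, and let $\ell^1(\mathbb N)$ be equipped with pointwise multiplication. Then the Banach algebra $\ell^1(G,\ell^1(\mathbb N))$, with the convolution product $\ast$, is not strongly Arens irregular.
   Context: All Banach algebras are complex. For a discrete group $G$ and a Banach algebra $\mathcal A$, $\ell^1(G,\mathcal A)$ is the Banach algebra of all absolutely summable functions $f:G\to\mathcal A$ with norm $\|f\|_1=\sum_{g\in G}\|f(g)\|$ and convolution product $(f\ast g)(x)=\sum_{s\in G}f(s)g(s^{-1}x)$, where the products $f(s)g(s^{-1}x)$ are taken in $\mathcal A$. Arens products. Let $\mathcal B$ be a Banach algebra. For $a\in\mathcal B$, $\omega\in\mathcal B^*$, $f\in\mathcal B^{**}$ define $\omega_a,{}_a\omega\in\mathcal B^*$ by $\omega_a(b)=\omega(ab)$ and ${}_a\omega(b)=\omega(ba)$ for $b\in\mathcal B$, and define $\omega_f,{}_f\omega\in\mathcal B^*$ by $\omega_f(a)=f({}_a\omega)$ and ${}_f\omega(a)=f(\omega_a)$ for $a\in\mathcal B$. The two Arens products on $\mathcal B^{**}$ are $(f\Box g)(\omega)=f({}_g\omega)$ and $(f\Diamond g)(\omega)=g(\omega_f)$ for $f,g\in\mathcal B^{**}$, $\omega\in\mathcal B^*$. The left and right topological centers are $Z_t^{(l)}(\mathcal B^{**})=\{\varphi\in\mathcal B^{**}:\varphi\Box\psi=\varphi\Diamond\psi\ \text{for all }\psi\in\mathcal B^{**}\}$ and $Z_t^{(r)}(\mathcal B^{**})=\{\varphi\in\mathcal B^{**}:\psi\Box\varphi=\psi\Diamond\varphi\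 \text{for all }\psi\in\mathcal B^{**}\}$. Let $J:\mathcal B\to\mathcal B^{**}$ be the canonical embedding. $\mathcal B$ is left (resp. right) strongly Arens irregular if $Z_t^{(l)}(\mathcal B^{**})=J(\mathcal B)$ (resp. $Z_t^{(r)}(\mathcal B^{**})=J(\mathcal B)$), and strongly Arens irregular if it is both left and right strongly Arens irregular. *)

(* Defs.v *)
From HB Require Import structures.
From mathcomp Require Import all_boot all_order all_algebra finmap.
From mathcomp Require Import all_classical all_reals all_analysis.
From mathcomp Require Import complex lra.

Set Implicit Arguments.
Unset Strict Implicit.
Unset Printing Implicit Defensive.

Import Order.TTheory GRing.Theory Num.Theory.
Import numFieldNormedType.Exports.

Local Open Scope classical_set_scope.
Local Open Scope complex_scope.
Local Open Scope ring_scope.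

Local Lemma le_real_complex (R : realType) (a b : R) :
  (a%:C <= b%:C :> R[i]) = (a <= b).
Proof. exact: lecR. Qed.

Local Lemma lt_real_complex (R : realType) (a b : R) :
  (a%:C < b%:C :> R[i]) = (a < b).
Proof. exact: ltcR. Qed.

(* The norm of a normed module over R[i] takes its values in R[i]; [nrm] is the
   same norm with values in R. *)
Definition nrm (R : realType) (V : normedModType R[i]) (x : V) : R :=
  complex.Re `|x|.

Section nrm_theory.
Variables (R : realType) (V : normedModType R[i]).
Implicit Types (x y : V) (k : R[i]).

Lemma nrmE x : `|x| = (nrm x)%:C.
Proof. by rewrite /nrm RRe_real ?normr_real. Qed.

Lemma nrm_ge0 x : 0 <= nrm x.
Proof. by rewrite -le_real_complex -nrmE; exact: normr_ge0. Qed.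

Lemma nrm0 : nrm (0 : V) = 0.
Proof. by rewrite /nrm normr0. Qed.

Lemma nrm0_eq0 x : nrm x = 0 -> x = 0.
Proof. by move=> x0; apply/eqP; rewrite -normr_eq0 nrmE x0. Qed.

Lemma nrmD x y : nrm (x + y) <= nrm x + nrm y.
Proof. by rewrite -le_real_complex rmorphD/= -!nrmE ler_normD. Qed.

Lemma nrmN x : nrm (- x) = nrm x.
Proof. by rewrite /nrm normrN. Qed.

Lemma nrmBC x y : nrm (x - y) = nrm (y - x).
Proof. by rewrite /nrm distrC. Qed.

Lemma nrmZ k x : nrm (k *: x) = nrm (k : R[i]^o) * nrm x.
Proof. by apply: complexI; rewrite rmorphM/= -!nrmE normrZ. Qed.

Lemma nrm_sum (I : Type) (s : seq I) (P : pred I) (f : I -> V) :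
  nrm (\sum_(i <- s | P i) f i) <= \sum_(i <- s | P i) nrm (f i).
Proof.
elim/big_ind2: _ => [|x1 x2 y1 y2 h1 h2|//]; first by rewrite nrm0.
exact: le_trans (nrmD _ _) (lerD h1 h2).
Qed.

Lemma nrm_cvgP (T : Type) (F : set_system T) {FF : Filter F} (f : T -> V) x :
  f @ F --> x <-> forall e : R, 0 < e -> \forall t \near F, nrm (x - f t) < e.
Proof.
split=> [/cvgrPdist_lt fx e e0|fx].
  have e0' : 0 < e%:C :> R[i] by rewrite lt_real_complex.
  by apply: filterS (fx _ e0') => t; rewrite nrmE lt_real_complex.
apply/cvgrPdist_lt => e e0.
have eE : e = (complex.Re e)%:C by rewrite RRe_real ?gtr0_real.
have e0' : 0 < complex.Re e by rewrite -lt_real_complex -eE.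
by apply: filterS (fx _ e0') => t; rewrite nrmE eE lt_real_complex.
Qed.

Lemma cvg_nrm_le (T : Type) (F : set_system T) {FF : ProperFilter F}
    (f : T -> V) x (M : R) :
  f @ F --> x -> (\forall t \near F, nrm (f t) <= M) -> nrm x <= M.
Proof.
move=> /nrm_cvgP fx fM; apply/ler_addgt0Pr => e e0.
have [t [xt tM]] := filter_ex (filterI (fx _ e0) fM).
rewrite -(subrK (f t) x) (le_trans (nrmD _ _))// addrC lerD// ltW//.
Qed.

End nrm_theory.

Lemma nrm_complexE (R : realType) (z : R[i]^o) :
  nrm z = Num.sqrt (complex.Re z ^+ 2 + complex.Im z ^+ 2).
Proof. exact: (congr1 (@complex.Re _) (normc_def z)). Qed.

Lemma nrm_complex_le (R : realType) (z : R[i]^o) :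
  `|complex.Re z| <= nrm z /\ `|complex.Im z| <= nrm z.
Proof.
rewrite nrm_complexE -!sqrtr_sqr.
by split; apply: ler_wsqrtr; rewrite ?lerDl ?lerDr sqr_ge0.
Qed.

Lemma complex_nrm_le (R : realType) (z : R[i]^o) :
  nrm z <= `|complex.Re z| + `|complex.Im z|.
Proof.
rewrite nrm_complexE -[leRHS]ger0_norm ?addr_ge0// -sqrtr_sqr.
rewrite ler_wsqrtr// sqrrD !real_normK ?num_real//.
by rewrite -addrA lerD2l lerDr mulrn_wge0// mulr_ge0.
Qed.

Lemma complex_complete (R : realType) (F : set_system R[i]^o) :
  ProperFilter F -> cauchy F -> cvg F.
Proof.
move=> FF Fc.
have Fe (e : R) : 0 < e -> exists z, F [set w | nrm (z - w : R[i]^o) < e].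
  move=> e0; have e0' : 0 < e%:C :> R[i] by rewrite lt_real_complex.
  have /cauchyP /(_ _ e0')[z Fz] := Fc.
  exists z; apply: filterS Fz => w.
  by rewrite -ball_normE/= nrmE lt_real_complex.
have cpart (p : R[i] -> R) : (forall z w, p (z - w) = p z - p w) ->
    (forall z : R[i]^o, `|p z| <= nrm z) -> cvg (p @ F).
  move=> pB pn; apply/cauchy_cvgP/cauchyP => e e0.
  have [z Fz] := Fe _ e0.
  exists (p z); change (F (p @^-1` ball (p z) e)); apply: filterS Fz => w /= zw.
  by rewrite -ball_normE/= -pB (le_lt_trans (pn _)).
have /cvg_ex[a Fa] : cvg (@complex.Re R @ F).
  by apply: cpart => [[? ?] [? ?]//|z]; case: (nrm_complex_le z).
have /cvg_ex[b Fb] : cvg (@complex.Im R @ F).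
  by apply: cpart => [[? ?] [? ?]//|z]; case: (nrm_complex_le z).
apply/cvg_ex; exists (a +i* b); rewrite -[F]/(id @ F).
apply/(@nrm_cvgP R R[i]^o) => e e0.
have e20 : 0 < e / 2 by rewrite divr_gt0.
move/cvgrPdist_lt : Fa => /(_ _ e20) Fa.
move/cvgrPdist_lt : Fb => /(_ _ e20) Fb.
apply: filterS (filterI Fa Fb) => -[x y] /= [xa yb].
rewrite (le_lt_trans (complex_nrm_le _))//= [e]splitr ltrD//.
Qed.

(* C as a Banach space over itself. The alias is needed because the library
   already uses the canonical key [_^o] for the completeness of the reals. *)
Definition Cspace (R : realType) : Type := R[i]^o.

HB.instance Definition _ (R : realType) := NormedModule.copy (Cspace R) R[i]^o.
HB.instance Definition _ (R : realType) :=
  Uniform_isComplete.Build (Cspace R) (@complex_complete R).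

Definition fset_filter (I : choiceType) : set_system {fset I} :=
  filter_from [set: {fset I}] (fun A => [set B | (A `<=` B)%fset]).
Arguments fset_filter : clear implicits.

#[global] Instance fset_filter_proper (I : choiceType) :
  ProperFilter (fset_filter I).
Proof.
apply: filter_from_proper => [|A _]; last by exists A => /=.
apply: filter_from_filter; first by exists fset0.
move=> A B _ _; exists (A `|` B)%fset => // C /=.
by rewrite fsubUset => /andP[].
Qed.

Lemma fset_filter_ge (I : choiceType) (A : {fset I}) :
  \forall B \near fset_filter I, (A `<=` B)%fset.
Proof. by exists A. Qed.

(* Unordered sum of a family; as for [lim], the value is meaningful only for
   convergent families, in particular for absolutely summable families in a
   complete space (lemma [usum_cvg]). *)
Definition usum (R : realType) (V : normedModType R[i]) (I : choiceType)
    (f : I -> V) : V :=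
  lim ((fun A : {fset I} => \sum_(i <- A) f i) @ fset_filter I).

Definition abs_summable (R : realType) (V : normedModType R[i])
    (I : choiceType) (f : I -> V) : Prop :=
  summable [set: I] (fun i => (nrm (f i))%:E).

Definition l1_norm (R : realType) (V : normedModType R[i])
    (I : choiceType) (f : I -> V) : R :=
  fine (\esum_(i in [set: I]) (nrm (f i))%:E).

Lemma fset_sum_sub (V : nmodType) (I : choiceType) (F : I -> V)
    (A B : {fset I}) : (A `<=` B)%fset ->
  \sum_(i <- B) F i = \sum_(i <- A) F i + \sum_(i <- B | i \notin A) F i.
Proof.
move=> AB; rewrite (bigID (mem A))/=; congr (_ + _).
rewrite [LHS]big_mkcond/= -(big_fset_incl _ AB) => [|x _ /negPf ->//].
by rewrite [LHS]big_seq [RHS]big_seq; apply: eq_bigr => i ->.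
Qed.

Section abs_summable_theory.
Variables (R : realType) (V : normedModType R[i]) (I : choiceType).
Implicit Types (f g : I -> V).

Lemma fset_sum_le_esum f (A : {fset I}) :
  ((\sum_(i <- A) nrm (f i))%:E <= \esum_(i in [set: I]) (nrm (f i))%:E)%E.
Proof.
apply: esum_ge; exists [set` A]; first by split.
by rewrite fsbig_finite//= set_fsetK sumEFin.
Qed.

Lemma esum_le_bound f (M : R) :
  (forall A : {fset I}, \sum_(i <- A) nrm (f i) <= M) ->
  (\esum_(i in [set: I]) (nrm (f i))%:E <= M%:E)%E.
Proof.
move=> fM; apply: ge_ereal_sup => _ [A [finA _] <-].
by rewrite fsbig_finite//= sumEFin lee_fin.
Qed.

Lemma abs_summableE f :
  abs_summable f <-> (\esum_(i in [set: I]) (nrm (f i))%:E < +oo)%E.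
Proof.
rewrite /abs_summable /summable.
by under eq_esum => i _ do rewrite abse_EFin ger0_norm ?nrm_ge0//.
Qed.

Lemma abs_summableP f : abs_summable f <->
  exists M, forall A : {fset I}, \sum_(i <- A) nrm (f i) <= M.
Proof.
rewrite abs_summableE; split=> [foo|[M /esum_le_bound/le_lt_trans]]; last first.
  by apply; rewrite ltry.
exists (l1_norm f) => A; rewrite -lee_fin /l1_norm fineK ?fset_sum_le_esum//.
by rewrite ge0_fin_numE// esum_ge0// => i _; rewrite lee_fin nrm_ge0.
Qed.

Lemma sum_le_l1_norm f (A : {fset I}) :
  abs_summable f -> \sum_(i <- A) nrm (f i) <= l1_norm f.
Proof.
move=> /abs_summableE foo; rewrite -lee_fin /l1_norm fineK ?fset_sum_le_esum//.
by rewrite ge0_fin_numE// esum_ge0// => i _; rewrite lee_fin nrm_ge0.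
Qed.

Lemma l1_norm_le f (M : R) :
  (forall A : {fset I}, \sum_(i <- A) nrm (f i) <= M) -> l1_norm f <= M.
Proof.
move=> fM; have foo : abs_summable f by apply/abs_summableP; exists M.
move/abs_summableE : foo => foo; rewrite -lee_fin /l1_norm fineK.
  exact: esum_le_bound.
by rewrite ge0_fin_numE// esum_ge0// => i _; rewrite lee_fin nrm_ge0.
Qed.

Lemma l1_norm_ge0 f : abs_summable f -> 0 <= l1_norm f.
Proof. by move=> /(sum_le_l1_norm fset0); rewrite big_seq_fset0. Qed.

Lemma nrm_le_l1_norm f i : abs_summable f -> nrm (f i) <= l1_norm f.
Proof. by move=> /(sum_le_l1_norm [fset i]%fset); rewrite big_seq_fset1. Qed.

Lemma l1_norm_tail f (e : R) : abs_summable f -> 0 < e ->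
  exists A : {fset I}, forall B : {fset I},
    \sum_(i <- B | i \notin A) nrm (f i) <= e.
Proof.
move=> fs e0.
have [A fA] : exists A : {fset I}, l1_norm f - e < \sum_(i <- A) nrm (f i).
  apply: contrapT => /forallNP fA.
  have : l1_norm f <= l1_norm f - e.
    by apply: l1_norm_le => A; rewrite leNgt; apply/negP; exact: fA.
  by rewrite lerDl oppr_ge0 leNgt e0.
exists A => B; have := sum_le_l1_norm (A `|` B)%fset fs.
rewrite (fset_sum_sub _ (fsubsetUl A B)).
have -> : \sum_(i <- (A `|` B)%fset | i \notin A) nrm (f i) =
    \sum_(i <- B | i \notin A) nrm (f i).
  apply: eq_fbig_cond => // i; rewrite !inE/=.
  by case: (i \in A); rewrite ?andbF ?andbT.
lra.
Qed.

End abs_summable_theory.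

Section usum_theory.
Variables (R : realType) (V : completeNormedModType R[i]) (I : choiceType).
Implicit Types (f g : I -> V).

Lemma usum_cvg f : abs_summable f ->
  (fun A : {fset I} => \sum_(i <- A) f i) @ fset_filter I --> usum f.
Proof.
move=> fs; apply/cauchy_cvgP/cauchyP => e e0.
have eE : e = (complex.Re e)%:C by rewrite RRe_real ?gtr0_real.
have e20 : 0 < complex.Re e / 2.
  by rewrite divr_gt0// -lt_real_complex -eE.
have [A fA] := l1_norm_tail fs e20.
exists (\sum_(i <- A) f i).
apply: filterS (fset_filter_ge A) => B AB.
rewrite -ball_normE/= nrmE [ltRHS]eE lt_real_complex.
rewrite (fset_sum_sub f AB) opprD addNKr nrmN (le_lt_trans (nrm_sum _ _ _))//.
by rewrite (le_lt_trans (fA B))// [ltRHS]splitr ltrDl.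
Qed.

Lemma usum_eq f x :
  (fun A : {fset I} => \sum_(i <- A) f i) @ fset_filter I --> x -> usum f = x.
Proof. by move=> /(cvg_lim (@norm_hausdorff _ V)). Qed.

Lemma usumD f g : abs_summable f -> abs_summable g ->
  usum (fun i => f i + g i) = usum f + usum g.
Proof.
move=> fs gs; apply: usum_eq; under eq_fun do rewrite big_split/=.
by apply: cvgD; exact: usum_cvg.
Qed.

Lemma usumZ k f : abs_summable f -> usum (fun i => k *: f i) = k *: usum f.
Proof.
move=> fs; apply: usum_eq; under eq_fun do rewrite -scaler_sumr.
by apply: cvgZr; exact: usum_cvg.
Qed.

Lemma usum_single f j : (forall i, i != j -> f i = 0) -> usum f = f j.
Proof.
move=> f0; apply: usum_eq; apply: cvg_near_cst.
apply: filterS (fset_filter_ge [fset j]%fset) => A jA.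
rewrite -(big_fset_incl _ jA) ?big_seq_fset1// => i _.
by rewrite inE => /f0.
Qed.

Lemma nrm_usum_le f (M : R) : abs_summable f ->
  (forall A : {fset I}, \sum_(i <- A) nrm (f i) <= M) -> nrm (usum f) <= M.
Proof.
move=> fs fM; apply: (cvg_nrm_le (usum_cvg fs)).
by apply: filterE => A; exact: le_trans (nrm_sum _ _ _) (fM A).
Qed.

End usum_theory.

(* The Banach space l^1(I, V). *)
Definition l1_pred (R : realType) (I : choiceType) (V : normedModType R[i]) :
  {pred I -> V} := [pred f : I -> V | `[< abs_summable f >]].

Record l1 (R : realType) (I : choiceType) (V : normedModType R[i]) := L1 {
  l1_fun :> I -> V;
  _ : l1_fun \in @l1_pred R I V }.
Arguments l1 {R} I V.

Section l1_normed.
Variables (R : realType) (I : choiceType) (V : normedModType R[i]).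
Implicit Types (f g : l1 I V).

Lemma l1_submod_closed : submod_closed (@l1_pred R I V).
Proof.
split=> [|k f g].
  apply/asboolP/abs_summableP; exists 0 => A.
  by rewrite big1// => i _; rewrite nrm0.
move=> /asboolP/abs_summableP[M fM] /asboolP/abs_summableP[N gN].
apply/asboolP/abs_summableP; exists (nrm (k : R[i]^o) * M + N) => A.
apply: (@le_trans _ _
  (\sum_(i <- A) (nrm (k : R[i]^o) * nrm (f i) + nrm (g i)))).
  by apply: ler_sum => i _; rewrite -nrmZ; exact: nrmD.
by rewrite big_split/= -mulr_sumr lerD// ler_wpM2l// nrm_ge0.
Qed.

HB.instance Definition _ := GRing.isSubmodClosed.Build R[i] (I -> V)
  (@l1_pred R I V) l1_submod_closed.
HB.instance Definition _ := [isSub for @l1_fun R I V].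
HB.instance Definition _ := [Choice of l1 I V by <:].
HB.instance Definition _ := [SubChoice_isSubLmodule of l1 I V by <:].

Lemma l1_summable f : abs_summable f.
Proof. by case: f => f /= /asboolP. Qed.

Lemma l1P f g : (forall i, f i = g i) -> f = g.
Proof. by move=> fg; apply: val_inj; apply/funext. Qed.

Lemma l1_normD f g :
  (l1_norm (f + g : l1 I V))%:C <= (l1_norm f)%:C + (l1_norm g)%:C :> R[i].
Proof.
rewrite -rmorphD/= le_real_complex; apply: l1_norm_le => A.
rewrite (le_trans _ (lerD (sum_le_l1_norm A (l1_summable f))
  (sum_le_l1_norm A (l1_summable g))))// -big_split/=.
by apply: ler_sum => i _; exact: nrmD.
Qed.

Lemma l1_normZ_le (k : R[i]) f :
  l1_norm (k *: f : l1 I V) <= nrm (k : R[i]^o) * l1_norm f.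
Proof.
apply: l1_norm_le => A.
rewrite (le_trans _ (ler_wpM2l (nrm_ge0 _)
  (sum_le_l1_norm A (l1_summable f))))//.
by rewrite mulr_sumr; apply: ler_sum => i _; rewrite -nrmZ.
Qed.

Lemma l1_normZ (k : R[i]) f :
  (l1_norm (k *: f : l1 I V))%:C = `|k| * (l1_norm f)%:C.
Proof.
have -> : `|k| = (nrm (k : R[i]^o))%:C by rewrite -nrmE.
rewrite -rmorphM; congr (_ %:C); apply/eqP.
rewrite eq_le l1_normZ_le andTb.
have [nk0|nk0] := eqVneq (nrm (k : R[i]^o)) 0.
  by rewrite nk0 mul0r; apply: l1_norm_ge0; exact: l1_summable.
have k0 : k != 0 by apply: contra_neq nk0 => ->; rewrite /nrm normr0.
have {}nk0 : 0 < nrm (k : R[i]^o) by rewrite lt_neqAle eq_sym nk0 nrm_ge0.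
rewrite -ler_pdivlMl//.
rewrite -[f in leLHS](scalerK k0) (le_trans (l1_normZ_le _ _))//.
rewrite ler_wpM2r ?l1_norm_ge0//; first exact: l1_summable.
rewrite -[leRHS]mul1r ler_pdivlMr//.
rewrite -(@nrmZ R R[i]^o k^-1 k).
have -> : k^-1 *: (k : R[i]^o) = 1 by exact: mulVf.
by rewrite /nrm normr1.
Qed.

Lemma l1_norm0_eq0 f : (l1_norm f)%:C = 0 :> R[i] -> f = 0.
Proof.
move=> /complexI f0; apply: l1P => i; apply: nrm0_eq0; apply/eqP.
by rewrite eq_le nrm_ge0 -f0 nrm_le_l1_norm//; exact: l1_summable.
Qed.

HB.instance Definition _ := Lmodule_isNormed.Build R[i] (l1 I V)
  l1_normD l1_normZ l1_norm0_eq0.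

Lemma nrm_l1E f : nrm f = l1_norm f.
Proof. by []. Qed.

End l1_normed.

Lemma cvg_sum_nrm_le (R : realType) (V : normedModType R[i]) (T J : Type)
    (F : set_system T) {FF : ProperFilter F} (s : seq J) (f : T -> J -> V)
    (x : J -> V) (M : R) :
  (forall j, (f ^~ j) @ F --> x j) ->
  (\forall t \near F, \sum_(j <- s) nrm (f t j) <= M) ->
  \sum_(j <- s) nrm (x j) <= M.
Proof.
move=> fx fM.
have fe : forall e : R, 0 < e ->
    \forall t \near F, \sum_(j <- s) nrm (x j - f t j) <= e.
  elim: s {fM} => [|j s IH] e e0.
    by apply: filterE => t; rewrite big_nil ltW.
  have e20 : 0 < e / 2 by rewrite divr_gt0.
  have /nrm_cvgP/(_ _ e20) fj := fx j.
  apply: filterS (filterI fj (IH _ e20)) => t /= [h1 h2].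
  by rewrite big_cons [leRHS]splitr lerD// ltW.
apply/ler_addgt0Pr => e e0.
have [t [tM te]] := filter_ex (filterI fM (fe _ e0)).
rewrite (le_trans _ (lerD tM te))// -big_split/=; apply: ler_sum => j _.
by rewrite -[x j in leLHS](subrK (f t j)) addrC nrmD.
Qed.

Section l1_complete.
Variables (R : realType) (I : choiceType) (V : completeNormedModType R[i]).
Implicit Types (f g : l1 I V).

Lemma l1_eval_le f i : nrm (f i) <= nrm f.
Proof. by rewrite nrm_l1E; apply: nrm_le_l1_norm; exact: l1_summable. Qed.

Lemma l1_sum_le f (A : {fset I}) : \sum_(i <- A) nrm (f i) <= nrm f.
Proof. by rewrite nrm_l1E; apply: sum_le_l1_norm; exact: l1_summable. Qed.

Definition mkl1 (f : I -> V) (fs : abs_summable f) : l1 I V :=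
  L1 (asboolT fs).

Lemma l1_complete (F : set_system (l1 I V)) :
  ProperFilter F -> cauchy F -> cvg F.
Proof.
move=> FF Fc.
have Fe (e : R) : 0 < e -> exists f, F [set g | nrm (f - g) < e].
  move=> e0; have e0' : 0 < e%:C :> R[i] by rewrite lt_real_complex.
  have /cauchyP/(_ _ e0')[f Ff] := Fc.
  exists f; apply: filterS Ff => g.
  by rewrite -ball_normE/= nrmE lt_real_complex.
have Fi i : cvg ((fun f : l1 I V => f i) @ F).
  apply/cauchy_cvgP/cauchyP => e e0.
  have eE : e = (complex.Re e)%:C by rewrite RRe_real ?gtr0_real.
  have e0' : 0 < complex.Re e by rewrite -lt_real_complex -eE.
  have [f Ff] := Fe _ e0'; exists (f i).
  change (F ((fun f : l1 I V => f i) @^-1` ball (f i) e)).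
  apply: filterS Ff => g /= fg.
  rewrite -ball_normE/= nrmE [ltRHS]eE lt_real_complex.
  exact: le_lt_trans (l1_eval_le (f - g) i) fg.
pose h i := lim ((fun f : l1 I V => f i) @ F).
have Fh (f : l1 I V) (e : R) : F [set g | nrm (f - g) < e] ->
    forall A : {fset I}, \sum_(i <- A) nrm (f i - h i) <= e.
  move=> Ff A.
  apply: (@cvg_sum_nrm_le _ _ _ _ F _ A (fun (g : l1 I V) i => f i - g i)).
    by move=> i; apply: cvgB; [exact: cvg_cst|exact: Fi].
  apply: filterS Ff => g /= fg; apply: le_trans (ltW fg).
  exact: (l1_sum_le (f - g) A).
have hs : abs_summable h.
  have [f Ff] := Fe 1 ltr01; have fh := Fh _ _ Ff.
  apply/abs_summableP; exists (nrm f + 1) => A.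
  rewrite (le_trans _ (lerD (l1_sum_le f A) (fh A)))// -big_split/=.
  apply: ler_sum => i _; rewrite -[h i in leLHS](subrK (f i)) addrC.
  by rewrite (le_trans (nrmD _ _))// [in leLHS]nrmBC.
apply/cvg_ex; exists (mkl1 hs).
rewrite -[F]/((id : l1 I V -> l1 I V) @ F).
apply/nrm_cvgP => e e0.
have e20 : 0 < e / 2 by rewrite divr_gt0.
have [f Ff] := Fe _ e20.
apply: filterS (Ff) => g /= fg.
rewrite -(subrK f (mkl1 hs)) -addrA (le_lt_trans (nrmD _ _))//.
rewrite [ltRHS]splitr ler_ltD// nrmBC nrm_l1E.
by apply: l1_norm_le => A; exact: (Fh _ _ Ff A).
Qed.

HB.instance Definition _ := Uniform_isComplete.Build (l1 I V) l1_complete.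

End l1_complete.

Section l1_single.
Variables (R : realType) (I : choiceType) (V : completeNormedModType R[i]).
Implicit Types (f : l1 I V) (v : V).

Definition single_fun (j : I) v : I -> V := fun i => if i == j then v else 0.

Lemma single_le j v (A : {fset I}) :
  \sum_(i <- A) nrm (single_fun j v i) <= nrm v.
Proof.
have [jA|jA] := boolP (j \in A); last first.
  rewrite big_seq big1 ?nrm_ge0// => i iA.
  rewrite /single_fun; case: eqP => [ij|_]; last by rewrite nrm0.
  by rewrite -ij iA in jA.
rewrite (big_fsetD1 _ jA)/= /single_fun eqxx big_seq big1 ?addr0// => i.
by rewrite !inE => /andP[/negPf-> _]; rewrite nrm0.
Qed.

Lemma single_summable j v : abs_summable (single_fun j v).
Proof. by apply/abs_summableP; exists (nrm v) => A; exact: single_le. Qed.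

Definition l1_single (j : I) v : l1 I V := mkl1 (single_summable j v).

Lemma l1_singleE j v i : l1_single j v i = if i == j then v else 0.
Proof. by []. Qed.

Lemma nrm_single j v : nrm (l1_single j v) = nrm v.
Proof.
apply/eqP; rewrite eq_le; apply/andP; split.
  by rewrite nrm_l1E; apply: l1_norm_le => A; exact: single_le.
by have := l1_eval_le (l1_single j v) j; rewrite l1_singleE eqxx.
Qed.

(* Finitely supported functions are dense, so a bounded additive map vanishing
   on all the functions [l1_single j v] is zero. *)
Lemma l1_ext0 (W : normedModType R[i]) (L : l1 I V -> W) (M : R) :
  {morph L : f g / f + g} -> (forall f, nrm (L f) <= M * nrm f) ->
  (forall j v, L (l1_single j v) = 0) -> forall f, L f = 0.
Proof.
move=> LD LM L0 f; apply: nrm0_eq0; apply/eqP.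
have M0 : 0 <= `|M| + 1 by rewrite addr_ge0.
rewrite eq_le nrm_ge0 andbT; apply/ler_addgt0Pr => e e0; rewrite add0r.
have Mp : 0 < `|M| + 1 by rewrite ltr_wpDl.
have e0' : 0 < e / (`|M| + 1) by rewrite divr_gt0.
have [A fA] := l1_norm_tail (l1_summable f) e0'.
pose g := \sum_(j <- A) l1_single j (f j).
have gE i : g i = if i \in A then f i else 0.
  have -> : g i = \sum_(j <- A) l1_single j (f j) i.
    rewrite /g; elim/big_rec2: _ => [//|j x y _ <-]; by [].
  have [iA|iA] := boolP (i \in A).
    rewrite (big_fsetD1 _ iA)/= /single_fun eqxx big_seq big1 ?addr0// => j.
    by rewrite !inE eq_sym => /andP[/negPf-> _].
  rewrite big_seq big1// => j jA; rewrite l1_singleE; case: eqP => [ij|//].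
  by rewrite ij jA in iA.
have Lz : L 0 = 0 by apply: (addrI (L 0)); rewrite -LD !addr0.
have Lg : L g = 0.
  rewrite /g; elim/big_rec: _ => // j x _ Lx.
  by rewrite LD L0 Lx addr0.
have -> : L f = L (f - g) + L g by rewrite -LD subrK.
rewrite Lg addr0.
rewrite (le_trans (LM _))// (@le_trans _ _ ((`|M| + 1) * nrm (f - g)))//.
  by rewrite ler_wpM2r ?nrm_ge0// (le_trans (ler_norm M))// lerDl.
rewrite mulrC -ler_pdivlMr// nrm_l1E; apply: l1_norm_le => B.
apply: le_trans (fA B); rewrite [leRHS]big_mkcond/=.
apply: ler_sum => i _.
change (nrm (f i - g i) <= if i \notin A then nrm (f i) else 0).
by rewrite gE; case: ifP; rewrite ?subrr ?nrm0// subr0.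
Qed.

End l1_single.

(* Complex Banach algebras; no unit is required, so the ring structures of the
   library do not apply. *)
HB.mixin Record isBanachAlgebra (R : realType) A
    & CompleteNormedModule R[i] A := {
  bmul : A -> A -> A;
  bmulA : associative bmul;
  bmulDl : forall a b c : A, bmul (a + b) c = bmul a c + bmul b c;
  bmulDr : forall a b c : A, bmul a (b + c) = bmul a b + bmul a c;
  bmulZl : forall (k : R[i]) (a b : A), bmul (k *: a) b = k *: bmul a b;
  bmulZr : forall (k : R[i]) (a b : A), bmul a (k *: b) = k *: bmul a b;
  norm_bmul : forall a b : A, `|bmul a b| <= `|a| * `|b|
}.

#[short(type="banachAlgType")]
HB.structure Definition BanachAlgebra (R : realType) :=
  {A of CompleteNormedModule R[i] A & isBanachAlgebra R A}.

Section banach_algebra_theory.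
Variables (R : realType) (A : banachAlgType R).
Implicit Types a b : A.

Lemma bmul0l a : bmul 0 a = 0.
Proof. by have := bmulZl 0 (0 : A) a; rewrite !scale0r. Qed.

Lemma bmul0r a : bmul a 0 = 0.
Proof. by have := bmulZr 0 a (0 : A); rewrite !scale0r. Qed.

Lemma nrm_bmul a b : nrm (bmul a b) <= nrm a * nrm b.
Proof. by rewrite -le_real_complex rmorphM/= -!nrmE; exact: norm_bmul. Qed.

End banach_algebra_theory.

(* l^1(N) with pointwise multiplication. *)
Definition l1N (R : realType) : Type := l1 nat (Cspace R).

Section l1N_algebra.
Variable R : realType.

HB.instance Definition _ :=
  CompleteNormedModule.copy (l1N R) (l1 nat (Cspace R)).

Implicit Types (f g h : l1N R).

Definition l1N_mul_fun f g : nat -> Cspace R :=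
  fun n => (f n : R[i]) * (g n : R[i]).

Lemma l1N_mul_le f g (A : {fset nat}) :
  \sum_(n <- A) nrm (l1N_mul_fun f g n) <= nrm f * nrm g.
Proof.
rewrite (le_trans _ (ler_wpM2r (nrm_ge0 g) (l1_sum_le f A)))// mulr_suml.
apply: ler_sum => n _.
rewrite [leLHS](nrmZ (f n : R[i]) (g n)) ler_wpM2l ?nrm_ge0//.
exact: l1_eval_le.
Qed.

Lemma l1N_mul_summable f g : abs_summable (l1N_mul_fun f g).
Proof.
by apply/abs_summableP; exists (nrm f * nrm g) => A; exact: l1N_mul_le.
Qed.

Definition l1N_mul f g : l1N R := mkl1 (l1N_mul_summable f g).

Lemma l1N_mulE f g n : l1N_mul f g n = (f n : R[i]) * (g n : R[i]) :> R[i].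
Proof. by []. Qed.

Lemma l1N_addE f g n : (f + g) n = (f n : R[i]) + (g n : R[i]) :> R[i].
Proof. by []. Qed.

Lemma l1N_scaleE (k : R[i]) f n : (k *: f) n = k * (f n : R[i]) :> R[i].
Proof. by []. Qed.

Lemma l1N_mulA : associative l1N_mul.
Proof. by move=> f g h; apply: l1P => n; rewrite !l1N_mulE mulrA. Qed.

Lemma l1N_mulDl f g h : l1N_mul (f + g) h = l1N_mul f h + l1N_mul g h.
Proof. by apply: l1P => n; rewrite l1N_addE !l1N_mulE l1N_addE mulrDl. Qed.

Lemma l1N_mulDr f g h : l1N_mul f (g + h) = l1N_mul f g + l1N_mul f h.
Proof. by apply: l1P => n; rewrite l1N_addE !l1N_mulE l1N_addE mulrDr. Qed.

Lemma l1N_mulZl (k : R[i]) f g : l1N_mul (k *: f) g = k *: l1N_mul f g.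
Proof. by apply: l1P => n; rewrite l1N_scaleE !l1N_mulE l1N_scaleE mulrA. Qed.

Lemma l1N_mulZr (k : R[i]) f g : l1N_mul f (k *: g) = k *: l1N_mul f g.
Proof. by apply: l1P => n; rewrite l1N_scaleE !l1N_mulE l1N_scaleE mulrCA. Qed.

Lemma norm_l1N_mul f g : `|l1N_mul f g| <= `|f| * `|g|.
Proof.
rewrite !nrmE -rmorphM le_real_complex nrm_l1E.
by apply: l1_norm_le => A; exact: l1N_mul_le.
Qed.

HB.instance Definition _ := isBanachAlgebra.Build R (l1N R)
  l1N_mulA l1N_mulDl l1N_mulDr l1N_mulZl l1N_mulZr norm_l1N_mul.

End l1N_algebra.

(* l^1(G, A) with convolution. *)
Definition l1G (R : realType) (G : groupType) (A : banachAlgType R) : Type :=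
  l1 G A.
Arguments l1G {R} G A.

Section convolution.
Variables (R : realType) (G : groupType) (A : banachAlgType R).

HB.instance Definition _ := CompleteNormedModule.copy (l1G G A) (l1 G A).

Implicit Types (f g h : l1G G A).

Definition conv_term f g x : G -> A := fun s => bmul (f s) (g (s^-1 * x)%g).

Definition conv_fun f g : G -> A :=
  fun x => usum (conv_term f g x).

Lemma translate_le g s (X : {fset G}) :
  \sum_(x <- X) nrm (g (s^-1 * x)%g) <= nrm g.
Proof.
have inj : {in X &, injective (fun x => (s^-1 * x)%g)}.
  by move=> x y _ _; exact: mulgI.
have := l1_sum_le g [fset (s^-1 * x)%g | x in X]%fset.
by rewrite big_imfset.
Qed.

Lemma conv_term_le f g (S X : {fset G}) :
  \sum_(x <- X) nrm (\sum_(s <- S) conv_term f g x s) <= nrm f * nrm g.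
Proof.
rewrite (le_trans _ (ler_wpM2r (nrm_ge0 g) (l1_sum_le f S)))//.
apply: (@le_trans _ _
  (\sum_(x <- X) \sum_(s <- S) nrm (f s) * nrm (g (s^-1 * x)%g))).
  apply: ler_sum => x _; rewrite (le_trans (nrm_sum _ _ _))//.
  by apply: ler_sum => s _; exact: nrm_bmul.
rewrite exchange_big/= mulr_suml; apply: ler_sum => s _.
by rewrite -mulr_sumr ler_wpM2l ?nrm_ge0//; exact: translate_le.
Qed.

Lemma conv_term_summable f g x : abs_summable (conv_term f g x).
Proof.
apply/abs_summableP; exists (nrm f * nrm g) => S.
rewrite (le_trans _ (ler_wpM2r (nrm_ge0 g) (l1_sum_le f S)))// mulr_suml.
apply: ler_sum => s _; rewrite (le_trans (nrm_bmul _ _))//.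
by rewrite ler_wpM2l ?nrm_ge0// l1_eval_le.
Qed.

Lemma conv_le f g (X : {fset G}) :
  \sum_(x <- X) nrm (conv_fun f g x) <= nrm f * nrm g.
Proof.
apply: (@cvg_sum_nrm_le _ _ _ _ (fset_filter G) _ X
  (fun (S : {fset G}) x => \sum_(s <- S) conv_term f g x s)).
  by move=> x; apply: usum_cvg; exact: conv_term_summable.
by apply: filterE => S; exact: conv_term_le.
Qed.

Lemma conv_summable f g : abs_summable (conv_fun f g).
Proof. by apply/abs_summableP; exists (nrm f * nrm g) => X; exact: conv_le. Qed.

Definition conv f g : l1G G A := mkl1 (conv_summable f g).

Lemma convE f g x : conv f g x = usum (fun s => bmul (f s) (g (s^-1 * x)%g)).
Proof. by []. Qed.

Lemma nrm_conv f g : nrm (conv f g) <= nrm f * nrm g.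
Proof. by rewrite nrm_l1E; apply: l1_norm_le => X; exact: conv_le. Qed.

Lemma convDl f g h : conv (f + g) h = conv f h + conv g h.
Proof.
apply: l1P => x; rewrite -[RHS]usumD; [|exact: conv_term_summable..].
by congr usum; apply/funext => s; exact: bmulDl.
Qed.

Lemma convDr f g h : conv f (g + h) = conv f g + conv f h.
Proof.
apply: l1P => x; rewrite -[RHS]usumD; [|exact: conv_term_summable..].
by congr usum; apply/funext => s; exact: bmulDr.
Qed.

Lemma convZl (k : R[i]) f g : conv (k *: f) g = k *: conv f g.
Proof.
apply: l1P => x; rewrite -[RHS]usumZ; last exact: conv_term_summable.
by congr usum; apply/funext => s; exact: bmulZl.
Qed.

Lemma convZr (k : R[i]) f g : conv f (k *: g) = k *: conv f g.
Proof.
apply: l1P => x; rewrite -[RHS]usumZ; last exact: conv_term_summable.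
by congr usum; apply/funext => s; exact: bmulZr.
Qed.

Lemma conv_single s t (a b : A) :
  conv (l1_single s a) (l1_single t b) = l1_single (s * t)%g (bmul a b).
Proof.
apply: l1P => x; rewrite [LHS](@usum_single _ _ _ _ s) => [|r rs].
  rewrite /conv_term !l1_singleE eqxx -(inj_eq (mulgI s) _ t) mulVKg.
  by case: ifP => //; rewrite bmul0r.
by rewrite /conv_term l1_singleE (negPf rs) bmul0l.
Qed.

Lemma convA : associative conv.
Proof.
have B f g h : nrm (conv f (conv g h)) <= nrm f * nrm g * nrm h.
  rewrite (le_trans (nrm_conv _ _))// -mulrA ler_wpM2l ?nrm_ge0//.
  exact: nrm_conv.
have B' f g h : nrm (conv (conv f g) h) <= nrm f * nrm g * nrm h.
  by rewrite (le_trans (nrm_conv _ _))// ler_wpM2r ?nrm_ge0// nrm_conv.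
pose L f g h := conv f (conv g h) - conv (conv f g) h.
have LB f g h : nrm (L f g h) <= nrm f * nrm g * nrm h *+ 2.
  by rewrite (le_trans (nrmD _ _))// nrmN mulr2n lerD.
suff L0 f g h : L f g h = 0.
  by move=> f g h; apply/eqP; rewrite -subr_eq0; apply/eqP; exact: L0.
apply: (@l1_ext0 _ _ _ _ (fun f => L f g h)
  (nrm g * nrm h *+ 2)) => [f1 f2|f1|s a].
- by rewrite /L !convDl opprD addrACA.
- by rewrite (le_trans (LB _ _ _))// mulrnAl -mulrA [nrm f1 * _]mulrC.
apply: (@l1_ext0 _ _ _ _ (fun g => L (l1_single s a) g h)
  (nrm (l1_single s a) * nrm h *+ 2)) => [g1 g2|g1|t b].
- by rewrite /L convDr !convDl convDr opprD addrACA.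
- by rewrite (le_trans (LB _ _ _))// mulrnAl mulrAC.
apply: (@l1_ext0 _ _ _ _ (fun h => L (l1_single s a) (l1_single t b) h)
  (nrm (l1_single s a) * nrm (l1_single t b) *+ 2)) => [h1 h2|h1|r c].
- by rewrite /L !convDr opprD addrACA.
- by rewrite (le_trans (LB _ _ _))// mulrnAl.
by rewrite /L !conv_single mulgA bmulA subrr.
Qed.

Lemma norm_conv f g : `|conv f g| <= `|f| * `|g|.
Proof. by rewrite !nrmE -rmorphM le_real_complex nrm_conv. Qed.

HB.instance Definition _ := isBanachAlgebra.Build R (l1G G A)
  convA convDl convDr convZl convZr norm_conv.

End convolution.

(* The Banach space dual, with the operator norm. *)
Definition dual_pred (R : realType) (V : normedModType R[i]) :
  {pred V -> R[i]^o} :=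
  [pred f : V -> R[i]^o | `[< linear f /\ continuous f >]].

Record dual (R : realType) (V : normedModType R[i]) := Dual {
  dual_fun :> V -> R[i]^o;
  _ : dual_fun \in @dual_pred R V }.

Section dual_lmodule.
Variables (R : realType) (V : normedModType R[i]).

Lemma dual_submod_closed : submod_closed (@dual_pred R V).
Proof.
split=> [|k f g].
  apply/asboolP; split=> [a x y|]; last exact: cst_continuous.
  by rewrite scaler0 addr0.
move=> /asboolP[fl fc] /asboolP[gl gc]; apply/asboolP; split=> [a x y|x].
  have E z : (k *: f + g) z = k *: f z + g z by [].
  rewrite !E fl gl !scalerDr !scalerA addrACA; congr (_ *: _ + _ + _).
  exact: mulrC.
by apply: cvgD; [apply: cvgZr; exact: fc|exact: gc].
Qed.

HB.instance Definition _ := GRing.isSubmodClosed.Build R[i] (V -> R[i]^o)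
  (@dual_pred R V) dual_submod_closed.
HB.instance Definition _ := [isSub for @dual_fun R V].
HB.instance Definition _ := [Choice of dual V by <:].
HB.instance Definition _ := [SubChoice_isSubLmodule of dual V by <:].

End dual_lmodule.

Section dual_normed.
Variables (R : realType) (V : normedModType R[i]).
Implicit Types (f g : dual V) (k : R[i]) (x y : V).

Lemma dualP f g : (forall x, f x = g x) -> f = g.
Proof. by move=> fg; apply: val_inj; apply/funext. Qed.

Lemma dual_linear f : linear f.
Proof. by case: f => f /= /asboolP[]. Qed.

Lemma dual_continuous f : continuous f.
Proof. by case: f => f /= /asboolP[]. Qed.

HB.instance Definition _ f :=
  GRing.isLinear.Build R[i] V R[i]^o _ (dual_fun f) (dual_linear f).

Lemma dualDE f g x : (f + g) x = f x + g x. Proof. by []. Qed.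
Lemma dualZE k f x : (k *: f) x = k *: f x. Proof. by []. Qed.

Lemma dual_bounded f : exists2 M, 0 <= M & forall x, nrm (f x) <= M * nrm x.
Proof.
have /linear_bounded_continuous/linear_boundedP := @dual_continuous f.
move=> /pinfty_ex_gt0[M M0 fM].
have ME : M = (complex.Re M)%:C by rewrite RRe_real ?gtr0_real.
exists (complex.Re M) => [|x].
  by rewrite -le_real_complex -ME; exact: ltW.
by have := fM x; rewrite ME !nrmE -rmorphM le_real_complex.
Qed.

Definition opnorm f : R := sup [set nrm (f x) | x in [set x | nrm x <= 1]].

Lemma opnorm_ub f x : nrm x <= 1 -> nrm (f x) <= opnorm f.
Proof.
move=> x1; apply: ub_le_sup; last by exists x.
have [M M0 fM] := dual_bounded f; exists M => _ [y /= y1 <-].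
by rewrite (le_trans (fM y))// -[leRHS]mulr1 ler_wpM2l.
Qed.

Lemma opnorm_le f (M : R) :
  (forall x, nrm x <= 1 -> nrm (f x) <= M) -> opnorm f <= M.
Proof.
move=> fM; apply: ge_sup; first by exists (nrm (f 0)), 0 => //=; rewrite nrm0.
by move=> _ [x /= x1 <-]; exact: fM.
Qed.

Lemma opnorm_ge0 f : 0 <= opnorm f.
Proof.
by apply: le_trans (opnorm_ub f (_ : nrm 0 <= 1)); rewrite ?nrm_ge0 ?nrm0.
Qed.

Lemma opnormP f x : nrm (f x) <= opnorm f * nrm x.
Proof.
have [/nrm0_eq0 ->|x0] := eqVneq (nrm x) 0.
  by rewrite linear0 !nrm0 mulr0.
have xp : 0 < nrm x by rewrite lt_neqAle eq_sym x0 nrm_ge0.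
pose k : R[i] := ((nrm x)^-1)%:C.
have nk : nrm (k : R[i]^o) = (nrm x)^-1.
  by rewrite nrm_complexE/= expr0n addr0 sqrtr_sqr ger0_norm// invr_ge0 nrm_ge0.
rewrite -ler_pdivrMr// mulrC -nk -nrmZ -linearZ.
by apply: opnorm_ub; rewrite nrmZ nk mulVf.
Qed.

Lemma opnorm_leP f (M : R) : 0 <= M -> (forall x, nrm (f x) <= M * nrm x) ->
  opnorm f <= M.
Proof.
move=> M0 fM; apply: opnorm_le => x x1.
by rewrite (le_trans (fM x))// -[leRHS]mulr1 ler_wpM2l.
Qed.

Lemma opnormD f g :
  (opnorm (f + g))%:C <= (opnorm f)%:C + (opnorm g)%:C :> R[i].
Proof.
rewrite -rmorphD le_real_complex; apply: opnorm_le => x x1.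
by rewrite dualDE (le_trans (nrmD _ _))// lerD// opnorm_ub.
Qed.

Lemma opnormZ_le k f : opnorm (k *: f) <= nrm (k : R[i]^o) * opnorm f.
Proof.
apply: opnorm_le => x x1.
by rewrite dualZE nrmZ ler_wpM2l ?nrm_ge0// opnorm_ub.
Qed.

Lemma opnormZ k f : (opnorm (k *: f))%:C = `|k| * (opnorm f)%:C.
Proof.
have -> : `|k| = (nrm (k : R[i]^o))%:C by rewrite -nrmE.
rewrite -rmorphM; congr (_ %:C); apply/eqP.
rewrite eq_le opnormZ_le andTb.
have [nk0|nk0] := eqVneq (nrm (k : R[i]^o)) 0.
  by rewrite nk0 mul0r; exact: opnorm_ge0.
have {}nk0 : 0 < nrm (k : R[i]^o) by rewrite lt_neqAle eq_sym nk0 nrm_ge0.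
rewrite mulrC -ler_pdivlMr//; apply: opnorm_le => x x1.
rewrite ler_pdivlMr// mulrC -nrmZ -dualZE.
exact: opnorm_ub.
Qed.

Lemma opnorm0_eq0 f : (opnorm f)%:C = 0 :> R[i] -> f = 0.
Proof.
move=> /complexI f0; apply: dualP => x; apply: nrm0_eq0; apply/eqP.
by rewrite eq_le nrm_ge0 andbT (le_trans (opnormP f x))// f0 mul0r.
Qed.

HB.instance Definition _ := Lmodule_isNormed.Build R[i] (dual V)
  opnormD opnormZ opnorm0_eq0.

Lemma nrm_dualE f : nrm f = opnorm f.
Proof. by []. Qed.

Lemma nrm_dual_ub f x : nrm (f x) <= nrm f * nrm x.
Proof. exact: opnormP. Qed.

Section mkdual.
Variables (f : V -> R[i]^o) (M : R).
Hypotheses (fl : linear f) (fM : forall x, nrm (f x) <= M * nrm x).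

Lemma bounded_linear_cont : continuous f.
Proof.
have fB x y : f (x - y) = f x - f y.
  by rewrite addrC -scaleN1r fl scaleN1r addrC.
move=> x; apply/nrm_cvgP => e e0.
have Mp : 0 < `|M| + 1 by rewrite ltr_wpDl.
have e0' : 0 < e / (`|M| + 1) by rewrite divr_gt0.
have /nrm_cvgP/(_ _ e0') := @cvg_id V (nbhs x).
apply: filterS => y; rewrite ltr_pdivlMr// mulrC => /(le_lt_trans _); apply.
rewrite -fB (le_trans (fM _))// ler_wpM2r ?nrm_ge0//.
by rewrite (le_trans (ler_norm M))// lerDl.
Qed.

Definition mkdual : dual V := Dual (asboolT (conj fl bounded_linear_cont)).

End mkdual.

End dual_normed.

Notation bidual V := (dual (dual V)).

Section canonical_embedding.
Variables (R : realType) (V : normedModType R[i]).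

Lemma J_linear (x : V) : linear (fun w : dual V => w x).
Proof. by []. Qed.

Lemma J_bounded (x : V) (w : dual V) : nrm (w x) <= nrm x * nrm w.
Proof. by rewrite mulrC; exact: nrm_dual_ub. Qed.

Definition canonical_embedding (x : V) : bidual V :=
  mkdual (J_linear x) (J_bounded x).

End canonical_embedding.

(* In the usual notation of the Arens products, [functional_mull w a] is w_a,
   [functional_mulr a w] is _a w, [bifunctional_mull w f] is w_f and
   [bifunctional_mulr f w] is _f w. *)
Section arens.
Variables (R : realType) (B : banachAlgType R).
Implicit Types (a b : B) (w : dual B) (f g : bidual B).

Section functional_mull.
Variables (w : dual B) (a : B).
Lemma functional_mull_linear : linear (fun b => w (bmul a b)).
Proof. by move=> k b c; rewrite bmulDr bmulZr linearP. Qed.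
Lemma functional_mull_bounded b : nrm (w (bmul a b)) <= nrm w * nrm a * nrm b.
Proof.
by rewrite (le_trans (nrm_dual_ub _ _))// -mulrA ler_wpM2l ?nrm_ge0// nrm_bmul.
Qed.
Definition functional_mull : dual B :=
  mkdual functional_mull_linear functional_mull_bounded.
Lemma nrm_functional_mull : nrm functional_mull <= nrm w * nrm a.
Proof.
apply: (@opnorm_leP _ _ functional_mull _ _ functional_mull_bounded).
by rewrite mulr_ge0 ?nrm_ge0.
Qed.
End functional_mull.

Section functional_mulr.
Variables (a : B) (w : dual B).
Lemma functional_mulr_linear : linear (fun b => w (bmul b a)).
Proof. by move=> k b c; rewrite bmulDl bmulZl linearP. Qed.
Lemma functional_mulr_bounded b : nrm (w (bmul b a)) <= nrm w * nrm a * nrm b.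
Proof.
rewrite (le_trans (nrm_dual_ub _ _))// -mulrA ler_wpM2l ?nrm_ge0// [leRHS]mulrC.
exact: nrm_bmul.
Qed.
Definition functional_mulr : dual B :=
  mkdual functional_mulr_linear functional_mulr_bounded.
Lemma nrm_functional_mulr : nrm functional_mulr <= nrm w * nrm a.
Proof.
apply: (@opnorm_leP _ _ functional_mulr _ _ functional_mulr_bounded).
by rewrite mulr_ge0 ?nrm_ge0.
Qed.
End functional_mulr.

Section bifunctional_mull.
Variables (w : dual B) (f : bidual B).
Lemma bifunctional_mull_linear : linear (fun a => f (functional_mulr a w)).
Proof.
move=> k a b; rewrite -linearP; congr (f _).
by apply: dualP => c; rewrite /= bmulDr bmulZr linearP.
Qed.
Lemma bifunctional_mull_bounded a :
  nrm (f (functional_mulr a w)) <= nrm f * nrm w * nrm a.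
Proof.
rewrite (le_trans (nrm_dual_ub _ _))// -mulrA ler_wpM2l ?nrm_ge0//.
exact: nrm_functional_mulr.
Qed.
Definition bifunctional_mull : dual B :=
  mkdual bifunctional_mull_linear bifunctional_mull_bounded.
Lemma nrm_bifunctional_mull : nrm bifunctional_mull <= nrm f * nrm w.
Proof.
apply: (@opnorm_leP _ _ bifunctional_mull _ _ bifunctional_mull_bounded).
by rewrite mulr_ge0 ?nrm_ge0.
Qed.
End bifunctional_mull.

Section bifunctional_mulr.
Variables (f : bidual B) (w : dual B).
Lemma bifunctional_mulr_linear : linear (fun a => f (functional_mull w a)).
Proof.
move=> k a b; rewrite -linearP; congr (f _).
by apply: dualP => c; rewrite /= bmulDl bmulZl linearP.
Qed.
Lemma bifunctional_mulr_bounded a :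
  nrm (f (functional_mull w a)) <= nrm f * nrm w * nrm a.
Proof.
rewrite (le_trans (nrm_dual_ub _ _))// -mulrA ler_wpM2l ?nrm_ge0//.
exact: nrm_functional_mull.
Qed.
Definition bifunctional_mulr : dual B :=
  mkdual bifunctional_mulr_linear bifunctional_mulr_bounded.
Lemma nrm_bifunctional_mulr : nrm bifunctional_mulr <= nrm f * nrm w.
Proof.
apply: (@opnorm_leP _ _ bifunctional_mulr _ _ bifunctional_mulr_bounded).
by rewrite mulr_ge0 ?nrm_ge0.
Qed.
End bifunctional_mulr.

Section box.
Variables f g : bidual B.
Lemma box_linear : linear (fun w => f (bifunctional_mulr g w)).
Proof.
move=> k v w; rewrite -linearP; congr (f _); apply: dualP => a.
change (g (functional_mull (k *: v + w) a) =
  k *: g (functional_mull v a) + g (functional_mull w a)).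
by rewrite -linearP; congr (g _); exact: dualP.
Qed.
Lemma box_bounded w : nrm (f (bifunctional_mulr g w)) <= nrm f * nrm g * nrm w.
Proof.
rewrite (le_trans (nrm_dual_ub _ _))// -mulrA ler_wpM2l ?nrm_ge0//.
exact: nrm_bifunctional_mulr.
Qed.
Definition box : bidual B := mkdual box_linear box_bounded.
End box.

Section diamond.
Variables f g : bidual B.
Lemma diamond_linear : linear (fun w => g (bifunctional_mull w f)).
Proof.
move=> k v w; rewrite -linearP; congr (g _); apply: dualP => a.
change (f (functional_mulr a (k *: v + w)) =
  k *: f (functional_mulr a v) + f (functional_mulr a w)).
by rewrite -linearP; congr (f _); exact: dualP.
Qed.
Lemma diamond_bounded w :
  nrm (g (bifunctional_mull w f)) <= nrm g * nrm f * nrm w.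
Proof.
rewrite (le_trans (nrm_dual_ub _ _))// -mulrA ler_wpM2l ?nrm_ge0//.
exact: nrm_bifunctional_mull.
Qed.
Definition diamond : bidual B := mkdual diamond_linear diamond_bounded.
End diamond.

End arens.

Definition left_topological_center (R : realType) (B : banachAlgType R) :
    set (bidual B) :=
  [set f | forall g, box f g = diamond f g].
Arguments left_topological_center {R} B.

Definition right_topological_center (R : realType) (B : banachAlgType R) :
    set (bidual B) :=
  [set f | forall g, box g f = diamond g f].
Arguments right_topological_center {R} B.

Definition left_strongly_arens_irregular (R : realType) (B : banachAlgType R) :
    Prop :=
  left_topological_center B = range (@canonical_embedding R B).

Definition right_strongly_arens_irregular (R : realType) (B : banachAlgType R) :
    Prop :=
  right_topological_center B = range (@canonical_embedding R B).

Definition strongly_arens_irregular (R : realType) (B : banachAlgType R) :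
    Prop :=
  left_strongly_arens_irregular B /\ right_strongly_arens_irregular B.

(* Main.v *)
Require Import Defs.
From mathcomp Require Import all_boot all_order all_algebra.
From mathcomp Require Import all_classical all_reals all_analysis.
From mathcomp Require Import complex.
Local Open Scope classical_set_scope.

Set Implicit Arguments.
Unset Strict Implicit.
Unset Printing Implicit Defensive.

Import Order.TTheory GRing.Theory Num.Theory.
Import numFieldNormedType.Exports.

Local Open Scope complex_scope.
Local Open Scope ring_scope.

(** Write B for l^1(G, l^1(N)) and e_n for the point mass at (1, n), where 1 is
    the identity of G. Left convolution by e_n restricts an element of B, seen
    as a function on G x N, to the slice G x {n}. The slices are disjoint, so a
    combination of the e_n with coefficients of modulus at most 1 acts on the
    left as a contraction ([point_mass_multiplier]).

    Let f be the limit of the J(e_n) along an ultrafilter U that contains the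
    tails of N. For g in B** and w in B*, write w_n for w_{e_n}, that is,
    b |-> w(e_n * b). Then
      (f box g)(w) = lim_U g(w_n)   and
      (f diamond g)(w) = g(w_f),
    with w_f(b) = lim_U w(e_n * b) = lim_U w_n(b).
    Rotating every g(w_n) to its modulus by a coefficient of modulus at most 1
    and using the contraction property gives sum_n |g(w_n)| <= |g| |w|. Hence
    g(w_n) tends to 0 for every g in B**, including g = J(b), and both Arens
    products of f with every g vanish: f lies in the left topological centre
    ([ultralimit_left_center]).

    But f does not come from B. If f = J(b), evaluating f at the coordinate
    functionals at (1, n) gives b(1, n) = 0 for all n, because for fixed n the
    coordinate of e_m is nonzero only for m = n. Then b is also killed by the
    functional that sums b(1, n) over n, whereas f takes the value 1 there. So
    left strong Arens irregularity fails. *)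

(** * Limits along an ultrafilter *)

(** Compactness provides a cluster point, and an ultrafilter converges to each
    of its cluster points. *)

Lemma ultra_cvg_compact (T : topologicalType) (K : set T) (I : Type)
    (U : set_system I) (u : I -> T) :
  UltraFilter U -> compact K -> (forall i, K (u i)) ->
  exists p : T, u @ U --> p.
Proof.
move=> UU Kc Ku.
have UK : (u @ U) K by apply: (@filterE _ U) => i; exact: Ku.
have [p [_ clp]] := Kc (u @ U) _ UK.
exists p => N Np.
have [//|UN] := in_ultra_setVsetC (u @^-1` N) UU.
by have [y [nNy]] := clp (~` N) N UN Np.
Qed.

Lemma ultra_cvg_bounded_real (R : realType) (I : Type) (U : set_system I)
    (u : I -> R) (M : R) :
  UltraFilter U -> (forall i, `|u i| <= M) -> cvg (u @ U).
Proof.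
move=> UU uM; apply/cvg_ex.
apply: (ultra_cvg_compact UU (@segment_compact R (- M) M)) => i.
by rewrite /= in_itv/= -ler_norml.
Qed.

Lemma ultra_cvg_bounded (R : realType) (I : Type) (U : set_system I)
    (u : I -> R[i]^o) (M : R) :
  UltraFilter U -> (forall i, nrm (u i) <= M) -> cvg (u @ U).
Proof.
move=> UU uM.
have /cvg_ex[a Ua] : cvg ((fun i => complex.Re (u i)) @ U).
  apply: (ultra_cvg_bounded_real UU) => i.
  exact: le_trans (nrm_complex_le (u i)).1 (uM i).
have /cvg_ex[b Ub] : cvg ((fun i => complex.Im (u i)) @ U).
  apply: (ultra_cvg_bounded_real UU) => i.
  exact: le_trans (nrm_complex_le (u i)).2 (uM i).
apply/cvg_ex; exists (a +i* b); apply/nrm_cvgP => e e0.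
have e20 : 0 < e / 2 by rewrite divr_gt0.
move/cvgrPdist_lt : Ua => /(_ _ e20) Ua.
move/cvgrPdist_lt : Ub => /(_ _ e20) Ub.
apply: filterS (filterI Ua Ub) => i /=.
case: (u i) => x y /= [xa yb].
by rewrite (le_lt_trans (complex_nrm_le _))//= [e]splitr ltrD.
Qed.

Section ultralimit.
Variables (R : realType) (V : normedModType R[i]) (a : nat -> V) (M : R).
Variables (U : set_system nat) (UU : UltraFilter U).
Hypothesis aM : forall n, nrm (a n) <= M.

Lemma ultralimit_cvg (w : dual V) :
  (fun n => w (a n)) @ U --> lim ((fun n => w (a n)) @ U).
Proof.
apply: (@ultra_cvg_bounded _ _ _ _ (nrm w * M)) => n.
by rewrite (le_trans (nrm_dual_ub _ _))// ler_wpM2l// nrm_ge0.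
Qed.

Lemma ultralimit_linear :
  linear (fun w : dual V => lim ((fun n => w (a n)) @ U) : R[i]^o).
Proof.
move=> k v w; apply: cvg_lim; first exact: norm_hausdorff.
by apply: cvgD; [apply: cvgZr|]; exact: ultralimit_cvg.
Qed.

Lemma ultralimit_bounded (w : dual V) :
  nrm (lim ((fun n => w (a n)) @ U) : R[i]^o) <= M * nrm w.
Proof.
apply: (cvg_nrm_le (@ultralimit_cvg w)); apply: filterE => n.
by rewrite mulrC (le_trans (nrm_dual_ub _ _))// ler_wpM2l// nrm_ge0.
Qed.

(** This is the weak-star limit in the bidual of the canonical images of the
    [a n]. *)
Definition ultralimit : bidual V := mkdual ultralimit_linear ultralimit_bounded.

Lemma ultralimit_eq (w : dual V) (z : R[i]^o) :
  (fun n => w (a n)) @ U --> z -> ultralimit w = z.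
Proof. by move=> wz; apply: cvg_lim => //; exact: norm_hausdorff. Qed.

End ultralimit.

(** * Sequences with unconditionally bounded left multipliers *)

Lemma cvg0_nrm_sum_le (R : realType) (V : normedModType R[i]) (u : nat -> V)
    (M : R) :
  (forall N, \sum_(n < N) nrm (u n) <= M) -> u @ \oo --> 0.
Proof.
move=> uM.
have /cvg_series_cvg_0/cvgrPdist_lt u0 : cvgn (series (fun n => nrm (u n))).
  apply: nondecreasing_is_cvgn.
    by apply: nondecreasing_series => n _ _; exact: nrm_ge0.
  by exists M => _ [N _ <-]; rewrite /series/= big_mkord.
apply/nrm_cvgP => e /u0; apply: filterS => n.
by rewrite !sub0r nrmN normrN ger0_norm// nrm_ge0.
Qed.

(** A bound on left multiplication that is uniform in the coefficients [c], and
    not only in [N], is what allows the phases in the next lemma to be chosen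
    depending on the functionals. *)
Section bounded_multipliers.
Variables (R : realType) (B : banachAlgType R) (a : nat -> B) (M : R).
Hypothesis M0 : 0 <= M.
Hypothesis aM : forall (N : nat) (c : nat -> R[i]) (b : B),
  (forall n, nrm (c n : R[i]^o) <= 1) ->
  nrm (bmul (\sum_(n < N) c n *: a n) b) <= M * nrm b.

(** Once every scalar [g (functional_mull w (a n))] is rotated to its modulus,
    the sum becomes the value of [g] at a single functional, whose norm is
    controlled by [aM]. *)
Lemma sum_nrm_functional_mull_le (g : bidual B) (w : dual B) (N : nat) :
  \sum_(n < N) nrm (g (functional_mull w (a n))) <= nrm g * (nrm w * M).
Proof.
pose z n : R[i] := g (functional_mull w (a n)).
(* If [z n = 0], then [c n = 0] by the convention on division by zero. *)
pose c n : R[i] := `|z n| / z n.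
have cM n : nrm (c n : R[i]^o) <= 1.
  rewrite -lecR -nrmE normf_div normr_id.
  have [->|z0] := eqVneq (z n) 0; first by rewrite normr0 mul0r ler01.
  by rewrite divff// normr_eq0.
have cz n : c n * z n = (nrm (z n : R[i]^o))%:C.
  have [z0|z0] := eqVneq (z n) 0; last by rewrite divfK// -nrmE.
  by rewrite z0 mulr0 nrm0.
pose v : dual B := \sum_(n < N) c n *: functional_mull w (a n).
have gv : g v = ((\sum_(n < N) nrm (z n : R[i]^o))%:C : R[i]^o).
  rewrite linear_sum/= rmorph_sum/=; apply: eq_bigr => n _.
  by rewrite linearZ/= -cz.
have vE b : v b = w (bmul (\sum_(n < N) c n *: a n) b).
  rewrite /v; elim/big_rec2: _ => [|n y x _ IH].
    by rewrite bmul0l linear0.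
  by rewrite bmulDl linearD dualDE dualZE IH bmulZl linearZ.
have vM : nrm v <= nrm w * M.
  apply: opnorm_leP => [|b]; first by rewrite mulr_ge0 ?nrm_ge0.
  rewrite vE (le_trans (nrm_dual_ub _ _))// -mulrA ler_wpM2l ?nrm_ge0//.
  exact: aM.
rewrite (le_trans _ (ler_wpM2l (nrm_ge0 g) vM))//.
rewrite (le_trans _ (nrm_dual_ub g v))//.
by rewrite -lecR -nrmE gv ger0_norm// lecR sumr_ge0// => n _; exact: nrm_ge0.
Qed.

Lemma functional_mull_cvg0 (g : bidual B) (w : dual B) :
  (fun n => g (functional_mull w (a n))) @ \oo --> (0 : R[i]^o).
Proof. exact: cvg0_nrm_sum_le (sum_nrm_functional_mull_le g w). Qed.

Variables (U : set_system nat) (UU : UltraFilter U) (L : R).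
Hypothesis Uoo : \oo `<=` U.
Hypothesis aL : forall n, nrm (a n) <= L.

(** Both Arens products of the limit with any [g] are zero: the first one is a
    limit of values of [g] which tend to 0, and in the second one [g] is
    evaluated at a functional which is itself zero, by the same fact applied to
    the elements of the canonical image. *)
Lemma ultralimit_left_center : left_topological_center B (ultralimit UU aL).
Proof.
move=> g; apply: dualP => w.
have -> : box (ultralimit UU aL) g w = 0.
  apply: ultralimit_eq => A /(functional_mull_cvg0 g w); exact: Uoo.
rewrite -[LHS](linear0 g); congr (g _); apply: dualP => b.
apply/esym/ultralimit_eq => A /(functional_mull_cvg0 (canonical_embedding b) w).
exact: Uoo.
Qed.

End bounded_multipliers.

(** * The point masses at the identity of the group *)

Lemma l1_sumE (R : realType) (I : choiceType) (V : normedModType R[i])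
    (N : nat) (f : nat -> l1 I V) (i : I) :
  (\sum_(n < N) f n) i = \sum_(n < N) f n i.
Proof. by elim/big_rec2: _ => [//|n y x _ <-]. Qed.

Lemma l1_nrm_le (R : realType) (I : choiceType) (V : completeNormedModType R[i])
    (f g : l1 I V) : (forall i, nrm (f i) <= nrm (g i)) -> nrm f <= nrm g.
Proof.
move=> fg; apply: l1_norm_le => A; apply: le_trans (l1_sum_le g A).
by apply: ler_sum => i _.
Qed.

Lemma usum_linear (R : realType) (I : choiceType)
    (V : completeNormedModType R[i]) :
  linear (fun f : l1 I V => usum f).
Proof.
move=> k f g; rewrite -usumZ; last exact: l1_summable.
by rewrite -usumD//; [exact: (l1_summable (k *: f))|exact: l1_summable].
Qed.

Section point_masses.
Variables (R : realType) (G : groupType).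
Local Notation B := (l1G G (l1N R)).

Definition point_mass (n : nat) : B :=
  l1_single (1%g : G) (l1_single n (1 : Cspace R) : l1N R).

Lemma nrm_point_mass n : nrm (point_mass n) <= 1.
Proof. by rewrite !nrm_single /nrm normr1. Qed.

(** Only the term at the identity survives in the convolution, so the product
    is pointwise on G x N. *)
Lemma bmul_identity_single (c : l1N R) (b : B) x m :
  (bmul (l1_single (1%g : G) c : B) b : B) x m = (c m : R[i]) * (b x m : R[i]).
Proof.
change (Defs.conv (l1_single (1%g : G) c) b x m =
  (c m : R[i]) * (b x m : R[i])).
rewrite convE (@usum_single _ _ _ _ (1%g : G)) => [|s s1].
  by rewrite l1_singleE eqxx invg1 mul1g.
by rewrite l1_singleE (negPf s1) bmul0l.
Qed.

(** By [bmul_identity_single] the sum acts as pointwise multiplication by a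
    function on N bounded by 1. *)
Lemma point_mass_multiplier (N : nat) (c : nat -> R[i]) (b : B) :
  (forall n, nrm (c n : R[i]^o) <= 1) ->
  nrm (@bmul R B (\sum_(n < N) c n *: point_mass n) b) <= 1 * nrm b.
Proof.
move=> c1; rewrite mul1r.
pose u n : l1N R := l1_single n (1 : Cspace R).
pose d : l1N R := \sum_(n < N) c n *: u n.
have dE m : d m = if (m < N)%N then c m else 0.
  have -> : d m = \sum_(n < N) (c n *: u n) m.
    exact: (@l1_sumE R nat (Cspace R) N (fun n => c n *: u n)).
  have E n : (c n *: u n) m = if n == m then c m else 0.
    rewrite l1N_scaleE l1_singleE eq_sym.
    by case: eqP => [->|_]; rewrite ?mulr1 ?mulr0.
  under eq_bigr do rewrite E.
  by rewrite -big_mkcond/=; exact: (big_ord1_eq (@GRing.add R[i]) (fun=> c m)).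
have -> : \sum_(n < N) c n *: point_mass n = l1_single (1%g : G) d :> B.
  apply: l1P => x; rewrite l1_singleE.
  transitivity (\sum_(n < N) (c n *: point_mass n) x).
    exact: (@l1_sumE R G (l1N R) N (fun n => c n *: point_mass n)).
  have E n : (c n *: point_mass n) x = if x == 1%g then c n *: u n else 0.
    change (c n *: (point_mass n x : l1N R) =
      if x == 1%g then c n *: u n else 0).
    by rewrite l1_singleE; case: ifP => //; rewrite scaler0.
  under eq_bigr do rewrite E.
  by case: ifP => // _; rewrite big1.
apply: l1_nrm_le => x; apply: l1_nrm_le => m.
rewrite bmul_identity_single.
rewrite [leLHS](nrmZ (d m : R[i]) (b x m)) -[leRHS]mul1r ler_wpM2r ?nrm_ge0//.
by rewrite dE; case: ifP => // _; rewrite nrm0.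
Qed.

Lemma identity_coordinate_linear n : linear (fun b : B => b 1%g n : R[i]^o).
Proof.
move=> k b c.
change ((k *: (b 1%g : l1N R) + (c 1%g : l1N R)) n =
  k * (b 1%g n : R[i]) + (c 1%g n : R[i])).
by rewrite l1N_addE l1N_scaleE.
Qed.

Lemma identity_coordinate_bounded n (b : B) :
  nrm (b 1%g n : R[i]^o) <= 1 * nrm b.
Proof.
by rewrite mul1r (le_trans _ (l1_eval_le b 1%g))// (l1_eval_le (b 1%g : l1N R)).
Qed.

Definition identity_coordinate n : dual B :=
  mkdual (identity_coordinate_linear n) (identity_coordinate_bounded n).

Lemma identity_total_linear :
  linear (fun b : B => usum (b 1%g : nat -> Cspace R) : R[i]^o).
Proof.
move=> k b c.
exact: (@usum_linear R nat (Cspace R) k (b 1%g) (c 1%g)).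
Qed.

Lemma identity_total_bounded (b : B) :
  nrm (usum (b 1%g : nat -> Cspace R) : R[i]^o) <= 1 * nrm b.
Proof.
rewrite mul1r (le_trans _ (l1_eval_le b 1%g))//.
apply: (@nrm_usum_le R (Cspace R)); first exact: (l1_summable (b 1%g)).
by move=> A; exact: l1_sum_le.
Qed.

Definition identity_total : dual B :=
  mkdual identity_total_linear identity_total_bounded.

End point_masses.

Theorem theorem3p1 (R : realType) (G : groupType) (hG : infinite_set [set: G]) :
  ~ strongly_arens_irregular (l1G G (l1N R)).
Proof.
move=> [left_irregular _].
have [U [UU Uoo]] := @ultraFilterLemma nat \oo _.
pose f := ultralimit UU (@nrm_point_mass R G).
have : left_topological_center (l1G G (l1N R)) f.
  exact: (ultralimit_left_center ler01 (@point_mass_multiplier R G)).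
rewrite left_irregular => -[b _ bf].
have f_coordinate n : f (identity_coordinate R G n) = 0.
  apply: ultralimit_eq; apply: cvg_near_cst; apply: Uoo.
  exists n.+1 => // m /= nm.
  by rewrite /single_fun eqxx /= /single_fun ltn_eqF.
have f_total : f (identity_total R G) = 1.
  apply: ultralimit_eq; apply: cvg_near_cst; apply: filterE => n /=.
  rewrite (@usum_single _ _ _ _ n) => [|m mn].
    by rewrite /single_fun eqxx /= /single_fun eqxx.
  by rewrite /single_fun eqxx /= /single_fun (negPf mn).
have b0 n : b 1%g n = 0 by rewrite -(f_coordinate n) -bf.
have : f (identity_total R G) = 0.
  by rewrite -bf/= (@usum_single _ _ _ _ 0%N).
by rewrite f_total => /eqP; rewrite oner_eq0.
Qed.
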